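(* Let $(M,P,g)$ be a Riemannian almost product $\mathcal{W}_3$-manifold, let $\nabla$ be the Levi-Civita connection of $g$ and let $\nabla'$ be the RPT-connection on $(M,P,g)$ with torsion $$T(x,y,z)=\tfrac12\{F(x,y,Pz)+F(y,z,Px)+F(z,x,Py)\}.$$ Then the scalar curvatures of $\nabla$ and $\nabla'$ are equal (as functions on $M$) if and only if $(M,P,g)$ is a Riemannian $P$-manifold, i.e. $\nabla P=0$.
   Context: A Riemannian almost product manifold $(M,P,g)$ is a differentiable manifold $M$ with a $(1,1)$-tensor field $P$ and a Riemannian metric $g$ such that $P^2x=x$, $g(Px,Py)=g(x,y)$; throughout $\mathrm{tr}\,P=0$. Put $F(x,y,z)=g((\nabla_xP)y,z)$. $(M,P,g)$ is a $\mathcal{W}_3$-manifold if $F(x,y,z)+F(y,z,x)+F(z,x,y)=0$ identically. For a linear connection $\nabla'$, $T(x,y)=\nabla'_xy-\nabla'_yx-[x,y]$ and $T(x,y,z)=g(T(x,y),z)$. An RPT-connection is a linear connection $\nabla'$ with $\nabla'P=\nabla'g=0$ whose torsion $T(x,y,z)$ is a 3-form. Thus here $\nabla'$ is given by $g(\nabla'_xy,z)=g(\nabla_xy,z)+\frac12T(x,y,z)$ with the stated $T$. Curvature: $R(x,y)z=\nabla_x\nabla_yz-\nabla_y\nabla_xz-\nabla_{[x,y]}z$, $R(x,y,z,w)=g(R(x,y)z,w)$; for a basis $\{e_i\}$ of $T_pM$ with inverse metric matrix $g^{ij}$, $\rho(y,z)=g^{ij}R(e_i,y,z,e_j)$ and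 the scalar curvature is $\tau=g^{ij}\rho(e_i,e_j)$. The scalar curvature of $\nabla'$ is defined by the same formulas for $\nabla'$. *)

(* Defs.v *)
From HB Require Import structures.
From mathcomp Require Import all_boot all_order all_algebra.
From mathcomp Require Import all_classical all_reals all_analysis.

Set Implicit Arguments.
Unset Strict Implicit.
Unset Printing Implicit Defensive.

Import Order.TTheory GRing.Theory Num.Theory.
Import numFieldNormedType.Exports.

Local Open Scope classical_set_scope.
Local Open Scope ring_scope.

(* C^k is usually stated with continuous partial derivatives; for A open,
   asking for Frechet differentiability at each order is equivalent when all
   orders are considered, as in [smooth_on]. *)
Fixpoint Ck (R : realType) (n : nat) (V : normedModType R) (k : nat)
    (A : set 'rV[R]_n) (f : 'rV[R]_n -> V) : Prop :=
  if k is k'.+1 then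
    (forall u, A u -> differentiable f u) /\
    (forall v : 'rV[R]_n, Ck k' A (fun u => 'D_v f u))
  else forall u, A u -> {for u, continuous f}.

Definition smooth_on (R : realType) (n : nat) (V : normedModType R)
    (A : set 'rV[R]_n) (f : 'rV[R]_n -> V) : Prop :=
  forall k, Ck k A f.

(* Charts and their inverses are total functions; the values of [chart i]
   outside [dom i], and of [param i] outside [chart i @` dom i], are junk.
   [chart_at] selects a chart around each point. *)
Record smoothManifold (R : realType) (n : nat) := SmoothManifold {
  mcarrier :> topologicalType ;
  m_hausdorff : hausdorff_space mcarrier ;
  m_second_countable : @second_countable mcarrier ;
  chart_index : Type ;
  dom : chart_index -> set mcarrier ;
  chart : chart_index -> mcarrier -> 'rV[R]_n ;
  param : chart_index -> 'rV[R]_n -> mcarrier ;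
  chart_at : mcarrier -> chart_index ;
  chart_atP : forall p, dom (chart_at p) p ;
  dom_open : forall i, open (dom i) ;
  chart_open : forall i, open (chart i @` dom i) ;
  chartK : forall i p, dom i p -> param i (chart i p) = p ;
  chart_continuous : forall i p, dom i p -> {for p, continuous (chart i)} ;
  param_continuous : forall i u, (chart i @` dom i) u ->
    {for u, continuous (param i)} ;
  transition_smooth : forall i j,
    smooth_on (chart i @` (dom i `&` dom j)) (chart j \o param i)
}.

Section Manifold.
Context {R : realType} {n : nat} {M : smoothManifold R n}.

Definition smooth_fun (U : set M) (f : M -> R) : Prop :=
  forall i, smooth_on (chart i @` (U `&` dom i)) (f \o param i).

(* T_pM is identified with 'rV[R]_n through the coordinate basis of the chart
   [chart_at p]; tangent vectors at distinct points are not comparable. *)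
Definition vfield : Type := M -> 'rV[R]_n.

Definition lie_deriv (X : vfield) (f : M -> R) : M -> R := fun p =>
  'D_(X p) (f \o param (chart_at p)) (chart (chart_at p) p).

Definition coord (i : chart_index M) (k : 'I_n) : M -> R :=
  fun p => chart i p 0 k.

(* The components of X in the chart i are the functions X(x^k). *)
Definition smooth_vfield (U : set M) (X : vfield) : Prop :=
  forall i k, smooth_fun (U `&` dom i) (lie_deriv X (coord i k)).

(* Z = [X, Y] means Z f = X (Y f) - Y (X f); take for f the coordinates. *)
Definition bracket (X Y : vfield) : vfield := fun p =>
  \row_k (lie_deriv X (lie_deriv Y (coord (chart_at p) k)) p
          - lie_deriv Y (lie_deriv X (coord (chart_at p) k)) p).

(* The k-th coordinate vector field of the chart i, on dom i. *)
Definition coord_vfield (i : chart_index M) (k : 'I_n) : vfield := fun q =>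
  'D_(delta_mx 0 k) (chart (chart_at q) \o param i) (chart i q).

(* Identities between vector fields range over the fields of every open subset
   of M, not only over the global ones. *)
Definition identically3 (Q : vfield -> vfield -> vfield -> M -> Prop) : Prop :=
  forall (U : set M) (X Y Z : vfield), open U ->
    smooth_vfield U X -> smooth_vfield U Y -> smooth_vfield U Z ->
    forall p, U p -> Q X Y Z p.

Definition identically2 (Q : vfield -> vfield -> M -> Prop) : Prop :=
  forall (U : set M) (X Y : vfield), open U ->
    smooth_vfield U X -> smooth_vfield U Y -> forall p, U p -> Q X Y p.

(* A (1,1)-tensor acts on the row vector u in T_pM by u *m P p. *)
Definition endo (P : M -> 'M[R]_n) (X : vfield) : vfield :=
  fun p => X p *m P p.

Definition inner (g : M -> 'M[R]_n) (X Y : vfield) : M -> R :=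
  fun p => (X p *m g p *m (Y p)^T) 0 0.

Record riemannian_metric (g : M -> 'M[R]_n) : Prop := RiemannianMetric {
  metric_sym : forall p, (g p)^T = g p ;
  metric_pos : forall p (u : 'rV[R]_n), u != 0 ->
    0 < (u *m g p *m u^T) 0 0 ;
  metric_smooth : forall (U : set M) (X Y : vfield), open U ->
    smooth_vfield U X -> smooth_vfield U Y -> smooth_fun U (inner g X Y)
}.

Record riemannian_almost_product (P g : M -> 'M[R]_n) : Prop :=
  RiemannianAlmostProduct {
  rap_metric : riemannian_metric g ;
  rap_smooth : forall (U : set M) (X : vfield), open U ->
    smooth_vfield U X -> smooth_vfield U (endo P X) ;
  rap_invol : forall p, P p *m P p = 1%:M ;
  rap_compat : forall p (u v : 'rV[R]_n),
    ((u *m P p) *m g p *m (v *m P p)^T) 0 0 = (u *m g p *m v^T) 0 0 ;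
  rap_trace : forall p, \tr (P p) = 0
}.

(* A linear connection, acting on vector fields defined on open subsets.
   Since vector fields are total functions here, compatibility with
   restriction is the axiom [conn_local]; the values of [nabla X Y] where X or
   Y is not smooth are junk. *)
Record connection := Connection {
  nabla :> vfield -> vfield -> vfield ;
  conn_local : forall (U : set M) (X X' Y Y' : vfield), open U ->
    smooth_vfield U X -> smooth_vfield U Y ->
    (forall p, U p -> X p = X' p) -> (forall p, U p -> Y p = Y' p) ->
    forall p, U p -> nabla X Y p = nabla X' Y' p ;
  conn_smooth : forall (U : set M) (X Y : vfield), open U ->
    smooth_vfield U X -> smooth_vfield U Y -> smooth_vfield U (nabla X Y) ;
  conn_linl : forall (U : set M) (f : M -> R) (X X' Y : vfield), open U ->
    smooth_fun U f ->
    smooth_vfield U X -> smooth_vfield U X' -> smooth_vfield U Y ->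
    forall p, U p ->
      nabla (fun q => f q *: X q + X' q) Y p
      = f p *: nabla X Y p + nabla X' Y p ;
  conn_addr : forall (U : set M) (X Y Y' : vfield), open U ->
    smooth_vfield U X -> smooth_vfield U Y -> smooth_vfield U Y' ->
    forall p, U p ->
      nabla X (fun q => Y q + Y' q) p = nabla X Y p + nabla X Y' p ;
  conn_leibniz : forall (U : set M) (f : M -> R) (X Y : vfield), open U ->
    smooth_fun U f -> smooth_vfield U X -> smooth_vfield U Y ->
    forall p, U p ->
      nabla X (fun q => f q *: Y q) p
      = lie_deriv X f p *: Y p + f p *: nabla X Y p
}.

Definition torsion (D : connection) (X Y : vfield) : vfield :=
  fun p => D X Y p - D Y X p - bracket X Y p.

Definition torsion3 (g : M -> 'M[R]_n) (D : connection) (X Y Z : vfield) :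
  M -> R := inner g (torsion D X Y) Z.

(* (D_X P) Y *)
Definition cov_endo (D : connection) (P : M -> 'M[R]_n) (X Y : vfield) :
  vfield := fun p => D X (endo P Y) p - endo P (D X Y) p.

(* (D_X g)(Y, Z) *)
Definition cov_metric (D : connection) (g : M -> 'M[R]_n) (X Y Z : vfield) :
  M -> R := fun p =>
  lie_deriv X (inner g Y Z) p - inner g (D X Y) Z p - inner g Y (D X Z) p.

Definition parallel_endo (D : connection) (P : M -> 'M[R]_n) : Prop :=
  identically2 (fun X Y p => cov_endo D P X Y p = 0).

Definition parallel_metric (D : connection) (g : M -> 'M[R]_n) : Prop :=
  identically3 (fun X Y Z p => cov_metric D g X Y Z p = 0).

Definition levi_civita (g : M -> 'M[R]_n) (D : connection) : Prop :=
  parallel_metric D g /\ identically2 (fun X Y p => torsion D X Y p = 0).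

Definition Ftensor (P g : M -> 'M[R]_n) (D : connection) (X Y Z : vfield) :
  M -> R := inner g (cov_endo D P X Y) Z.

Definition W3_manifold (P g : M -> 'M[R]_n) (D : connection) : Prop :=
  identically3 (fun X Y Z p =>
    Ftensor P g D X Y Z p + Ftensor P g D Y Z X p + Ftensor P g D Z X Y p = 0).

(* T(X, Y, Z) is always tensorial, so that being a 3-form amounts to being
   alternating. *)
Definition skew_torsion (g : M -> 'M[R]_n) (D : connection) : Prop :=
  identically3 (fun X Y Z p =>
    torsion3 g D Y X Z p = - torsion3 g D X Y Z p /\
    torsion3 g D X Z Y p = - torsion3 g D X Y Z p).

Definition RPT_connection (P g : M -> 'M[R]_n) (D : connection) : Prop :=
  [/\ parallel_endo D P, parallel_metric D g & skew_torsion g D].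

Definition curvature (D : connection) (X Y Z : vfield) : vfield := fun p =>
  D X (D Y Z) p - D Y (D X Z) p - D (bracket X Y) Z p.

Definition curvature4 (g : M -> 'M[R]_n) (D : connection)
  (X Y Z W : vfield) : M -> R := inner g (curvature D X Y Z) W.

(* g^{ij} at p, for a local frame e around p. *)
Definition inv_gram (g : M -> 'M[R]_n) (e : 'I_n -> vfield) (p : M) :
  'M[R]_n := invmx (\matrix_(i, j) inner g (e i) (e j) p).

Definition ricci (g : M -> 'M[R]_n) (D : connection) (e : 'I_n -> vfield)
    (Y Z : vfield) : M -> R := fun p =>
  \sum_i \sum_j inv_gram g e p i j * curvature4 g D (e i) Y Z (e j) p.

(* The traces do not depend on the basis of T_pM; the one of the chart
   [chart_at p] is used. *)
Definition scalar_curvature (g : M -> 'M[R]_n) (D : connection) : M -> R :=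
  fun p => let e := coord_vfield (chart_at p) in
  \sum_i \sum_j inv_gram g e p i j * ricci g D e (e i) (e j) p.

Definition riemannian_P_manifold (P : M -> 'M[R]_n) (D : connection) : Prop :=
  parallel_endo D P.

End Manifold.

Arguments vfield {R n} M.
Arguments connection {R n} M.

(* Main.v *)
Require Import Defs.
From mathcomp Require Import all_boot all_order all_algebra.
From mathcomp Require Import all_classical all_reals all_analysis.
From mathcomp Require Import ring lra.

Set Implicit Arguments.
Unset Strict Implicit.
Unset Printing Implicit Defensive.

Import Order.TTheory GRing.Theory Num.Theory.
Import numFieldNormedType.Exports.

Local Open Scope classical_set_scope.
Local Open Scope ring_scope.

(* [all_algebra] also exports a [coord]. *)
Local Notation coord := Defs.coord.

(* Put K(X, Y) = nabla'_X Y - nabla_X Y.  Both connections are metric, nabla is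
   torsion-free and nabla' has skew torsion, so g(K(X, Y), Z) is a 3-form, and
   expanding R' in terms of R and K gives
     tau' = tau - g^{ij} g^{kl} g(K(e_i, e_k), K(e_j, e_l)) = tau - |K|^2,
   the remaining terms being antisymmetric in (i, j) or in (k, l), up to terms
   that cancel in pairs.  Hence tau = tau' iff K = 0.  If K = 0 then
   nabla P = nabla' P = 0; conversely nabla P = 0 gives F = 0, hence T = 0, and
   T = 2 K. *)

(** * Functions of class C^k on open sets *)

Section LocalDifferentiability.
Context {R : realType} {V W : normedModType R}.

(** Differentiability depends only on the germ: the first order expansion of [f] at [x] is also one
    of [h], and uniqueness of the differential identifies its linear part with the differential of
    [h]. *)
Lemma near_eq_differentiable (f h : V -> W) (x : V) :
  (\near x, f x = h x) -> differentiable f x -> differentiable h x.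
Proof.
move=> fh df.
have E : h \o shift x = cst (h x) + 'd f x +o_ 0 id.
  rewrite -(nbhs_singleton fh).
  apply/eqaddoP => _/posnumP[e].
  have := diff_locally df; move=> /eqaddoP/(_ _ (gt0 e)) H.
  have fh' : \forall y \near (0 : V), (f \o shift x) y = (h \o shift x) y.
    by have := fh; rewrite (near_shift 0) subr0.
  near=> y; have -> : (h \o shift x - (cst (f x) + 'd f x)) y
     = (f \o shift x - (cst (f x) + 'd f x)) y.
    by rewrite /GRing.add /GRing.opp /=; congr (_ - _); apply/esym; near: y.
  by near: y.
have dc : continuous ('d f x) by exact: diff_continuous.
have dE := diff_unique dc E.
by apply/diff_locallyP; rewrite dE.
Unshelve. all: by end_near. Qed.
End LocalDifferentiability.

Section CkCalculus.
Context {R : realType} {n : nat}.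
Implicit Types (V : normedModType R) (A : set 'rV[R]_n) (k : nat).

Lemma open_near_eq V A (f h : 'rV[R]_n -> V) u : open A -> A u ->
  (forall u, A u -> f u = h u) -> \near u, f u = h u.
Proof. by move=> oA Au fh; apply: filterS (open_nbhs_nbhs (conj oA Au)). Qed.

Lemma Ck_sub V k A B (f : 'rV[R]_n -> V) : A `<=` B -> Ck k B f -> Ck k A f.
Proof.
move=> AB; elim: k f => [|k IH] f /=; first by move=> H u /AB /H.
by move=> [d H]; split=> [u /AB /d //|v]; exact: IH.
Qed.

(** As [A] is open, agreement on [A] is agreement near each of its points, so the directional
    derivatives agree on [A] too and the induction goes on. *)
Lemma Ck_eq V k A (f h : 'rV[R]_n -> V) : open A ->
  (forall u, A u -> f u = h u) -> Ck k A f -> Ck k A h.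
Proof.
move=> oA; elim: k f h => [|k IH] f h fh /=.
  move=> H u Au; have E := open_near_eq oA Au fh.
  have Hu : f @ u --> f u by exact: H.
  have -> : {for u, continuous h} = (h @ u --> f u) by rewrite (fh u Au).
  exact: cvg_trans (near_eq_cvg E) Hu.
move=> [d H]; split=> [u Au|v].
  exact: near_eq_differentiable (open_near_eq oA Au fh) (d u Au).
by apply: IH (H v) => u Au; apply: near_eq_derive; exact: open_near_eq fh.
Qed.

Lemma CkS V k A (f : 'rV[R]_n -> V) : Ck k.+1 A f -> Ck k A f.
Proof.
elim: k f => [|k IH] f.
  by move=> [d _] u Au; exact: differentiable_continuous (d u Au).
by move=> [d H]; split=> // v; apply: IH.
Qed.

Lemma Ck_cst V k A (a : V) : Ck k A (fun=> a).
Proof.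
elim: k a => [|k IH] a /=; first by move=> u _; exact: cst_continuous.
split=> [u _|v]; first exact: differentiable_cst.
have -> : (fun u => 'D_v (fun=> a) u) = (fun=> 0 : V).
  by apply: funext => u; exact: derive_cst.
exact: IH.
Qed.

Lemma CkD V k A (f h : 'rV[R]_n -> V) : open A ->
  Ck k A f -> Ck k A h -> Ck k A (fun u => f u + h u).
Proof.
move=> oA; elim: k f h => [|k IH] f h /=.
  by move=> Hf Hh u Au; exact: continuousD (Hf u Au) (Hh u Au).
move=> [df Hf] [dh Hh]; split=> [u Au|v].
  by apply: (@differentiableD _ _ _ f h); [exact: df|exact: dh].
apply: (Ck_eq oA _ (IH _ _ (Hf v) (Hh v))) => u Au.
by rewrite -deriveD //; apply: diff_derivable; [exact: df|exact: dh].
Qed.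

Lemma Ck_sum V k A (m : nat) (f : 'I_m -> 'rV[R]_n -> V) : open A ->
  (forall i, Ck k A (f i)) -> Ck k A (fun u => \sum_i f i u).
Proof.
move=> oA H; elim: m f H => [|m IH] f H.
  by apply: Ck_eq oA _ (Ck_cst k A 0) => u _; rewrite big_ord0.
apply: Ck_eq oA _ (CkD oA (H ord0) (IH (fun i => f (lift ord0 i)) _)) => //.
by move=> u _; rewrite big_ord_recl.
Qed.

(** The Leibniz rule keeps the factors themselves next to their derivatives, so the induction
    hypothesis is applied to [f] and [h] at the lower order, which [CkS] provides. *)
Lemma CkM k A (f h : 'rV[R]_n -> R) : open A ->
  Ck k A f -> Ck k A h -> Ck k A (fun u => f u * h u).
Proof.
move=> oA; elim: k f h => [|k IH] f h.
  by move=> Hf Hh u Au; exact: continuousM (Hf u Au) (Hh u Au).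
move=> Cf Ch; have [df Hf] := Cf; have [dh Hh] := Ch; split=> [u Au|v].
  by apply: (@differentiableM _ _ f h); [exact: df|exact: dh].
have H : Ck k A (fun u => f u * 'D_v h u + h u * 'D_v f u).
  apply: CkD => //; apply: IH; [exact: CkS Cf|exact: Hh|exact: CkS Ch|exact: Hf].
apply: (Ck_eq oA _ H) => u Au.
by rewrite deriveM //; apply: diff_derivable; [exact: df|exact: dh].
Qed.

Lemma Ck_coord k A (m : nat) (f : 'rV[R]_n -> 'rV[R]_m) (j : 'I_m) :
  open A -> Ck k A f -> Ck k A (fun u => f u 0 j).
Proof.
move=> oA; elim: k f => [|k IH] f /=.
  move=> H u Au.
  exact: (@continuous_comp _ _ _ f (fun w : 'rV[R]_m => w 0 j) u (H u Au)
    (@coord_continuous _ _ _ _ _ _)).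
move=> [d H]; split=> [u Au|v].
  exact: (@differentiable_comp _ _ _ _ f (fun w : 'rV[R]_m => w 0 j) u (d u Au)
    (differentiable_coord _ _ _)).
apply: (Ck_eq oA _ (IH _ (H v))) => u Au.
by rewrite derive_mx ?mxE //; apply: diff_derivable; exact: d.
Qed.

End CkCalculus.

(** * Chain rule in coordinates *)

Lemma derive_comp_coord (R : realType) (n m : nat) (V : normedModType R)
  (phi : 'rV[R]_n -> 'rV[R]_m) (f : 'rV[R]_m -> V) (u v : 'rV[R]_n) :
  differentiable phi u -> differentiable f (phi u) ->
  'D_v (f \o phi) u = 'D_('D_v phi u) f (phi u).
Proof.
move=> dp df; rewrite !deriveE //; last exact: differentiable_comp.
by rewrite diff_comp.
Qed.

(** Trades a direction that may vary with the point for fixed directions, the only ones that [Ck]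
    controls. *)
Lemma derive_sum_delta (R : realType) (m : nat) (V : normedModType R)
  (f : 'rV[R]_m -> V) (u v : 'rV[R]_m) : differentiable f u ->
  'D_v f u = \sum_j v 0 j *: 'D_(delta_mx 0 j) f u.
Proof.
move=> df; rewrite deriveE // {1}[v]row_sum_delta linear_sum /=.
by apply: eq_bigr => j _; rewrite linearZ /= deriveE.
Qed.

(** The chain rule differentiates [f] along the moving direction ['D_v phi u]. Expanded in the
    standard basis, this is a sum of products of components of ['D_v phi] with partial derivatives
    of [f] composed with [phi], to which the induction applies. *)
Lemma Ck_comp (R : realType) (n m : nat) k (A : set 'rV[R]_n) (B : set 'rV[R]_m)
  (phi : 'rV[R]_n -> 'rV[R]_m) (f : 'rV[R]_m -> R) : open A ->
  (forall u, A u -> B (phi u)) ->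
  Ck k A phi -> Ck k B f -> Ck k A (f \o phi).
Proof.
move=> oA AB; elim: k f => [|k IH] f.
  move=> Hp Hf u Au; exact: continuous_comp (Hp u Au) (Hf _ (AB u Au)).
move=> Cp Cf; have [dp Hp] := Cp; have [df Hf] := Cf; split=> [u Au|v].
  by apply: (differentiable_comp (dp u Au)); exact: df (AB _ Au).
have H : Ck k A (fun u => \sum_j ('D_v phi u) 0 j * ('D_(delta_mx 0 j) f \o phi) u).
  apply: Ck_sum => // j; apply: CkM => //; first exact: Ck_coord oA (Hp v).
  exact: IH (CkS Cp) (Hf _).
apply: (Ck_eq oA _ H) => u Au /=.
have dfu := df _ (AB u Au).
by rewrite (derive_comp_coord v (dp u Au) dfu) (derive_sum_delta _ dfu).
Qed.

(** * Smooth functions and vector fields on a manifold *)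

Section SmoothFields.
Context {R : realType} {n : nat} {M : smoothManifold R n}.
Implicit Types (U : set M) (p : M) (i j : chart_index M) (X Y : vfield M).

(** Inside the open image of [dom i], this set is the preimage of [U] under [param i], which is
    continuous there. *)
Lemma chart_image_open i U : open U -> open (chart i @` (U `&` dom i)).
Proof.
move=> oU; rewrite openE => _ [p [Up dp] <-]; rewrite /interior.
have ip : (chart i @` dom i) (chart i p) by exists p.
have Ni : nbhs (chart i p) (chart i @` dom i).
  by apply: open_nbhs_nbhs; split=> //; exact: chart_open.
have : nbhs (chart i p) (param i @^-1` U).
  by apply: (param_continuous ip); rewrite chartK //; exact: open_nbhs_nbhs.
apply: filterS2 Ni => _ [q dq <-] /=; rewrite chartK // => Uq.
by exists q.
Qed.

Lemma smooth_fun_sub U U' (f : M -> R) :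
  U `<=` U' -> smooth_fun U' f -> smooth_fun U f.
Proof.
move=> UU' sf i k; apply: Ck_sub (sf i k) => _ [q [Uq dq] <-].
by exists q => //; split=> //; exact: UU'.
Qed.

Lemma smooth_fun_eq U (f h : M -> R) : open U ->
  (forall p, U p -> f p = h p) -> smooth_fun U f -> smooth_fun U h.
Proof.
move=> oU fh sf i k; apply: (Ck_eq (chart_image_open oU) _ (sf i k)).
by move=> _ [q [Uq dq] <-] /=; rewrite chartK //; exact: fh.
Qed.

Lemma smooth_fun_cst U (a : R) : smooth_fun U (fun=> a).
Proof. by move=> i k; exact: Ck_cst. Qed.

Lemma smooth_funD U (f h : M -> R) : open U ->
  smooth_fun U f -> smooth_fun U h -> smooth_fun U (fun p => f p + h p).
Proof.
move=> oU sf sh i k.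
exact: CkD (chart_image_open oU) (sf i k) (sh i k).
Qed.

Lemma smooth_funM U (f h : M -> R) : open U ->
  smooth_fun U f -> smooth_fun U h -> smooth_fun U (fun p => f p * h p).
Proof.
move=> oU sf sh i k.
exact: CkM (chart_image_open oU) (sf i k) (sh i k).
Qed.

Lemma smooth_fun_differentiable U (f : M -> R) i p :
  smooth_fun U f -> U p -> dom i p -> differentiable (f \o param i) (chart i p).
Proof. by move=> sf Up dp; have [d _] := sf i 1%N; apply: d; exists p. Qed.

Lemma transition_differentiable i j p : dom i p -> dom j p ->
  differentiable (chart j \o param i) (chart i p).
Proof.
by move=> di dj; have [d _] := transition_smooth i j 1%N; apply: d; exists p.
Qed.

(** Near [chart i p] the map [F \o param i] factors through the transition map [chart j \o param i];
    the rest is the chain rule. *)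
Lemma derive_change_chart (V : normedModType R) (F : M -> V) i j p
    (v : 'rV[R]_n) : dom i p -> dom j p ->
  differentiable (F \o param j) (chart j p) ->
  'D_v (F \o param i) (chart i p) =
  'D_('D_v (chart j \o param i) (chart i p)) (F \o param j) (chart j p).
Proof.
move=> di dj dF.
have E : \forall u \near chart i p, (F \o param i) u =
    ((F \o param j) \o (chart j \o param i)) u.
  have oI := @chart_image_open i (dom j) (dom_open j).
  apply: (open_near_eq oI) => [|_ [q [dq dq'] <-]] /=; first by exists p.
  by rewrite chartK // chartK.
rewrite (near_eq_derive v E) derive_comp_coord /= ?chartK //.
exact: transition_differentiable.
Qed.

Lemma smooth_fun_coord i k : smooth_fun (dom i) (coord i k).
Proof.
move=> j m; apply: (@Ck_coord _ _ m _ _ (chart i \o param j)).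
  by apply: chart_image_open; exact: dom_open.
by rewrite setIC; exact: transition_smooth.
Qed.

Lemma lie_deriv_coord X i k p : dom i p ->
  lie_deriv X (coord i k) p =
  ('D_(X p) (chart i \o param (chart_at p)) (chart (chart_at p) p)) 0 k.
Proof.
move=> di; rewrite /lie_deriv [in RHS]derive_mx ?mxE //.
by apply: diff_derivable; exact: transition_differentiable (chart_atP p) di.
Qed.

(** The vector [coord_vfield i k p] is the [k]-th basis vector pushed through the transition from
    [i] to [chart_at p], so a change of chart brings the derivative back to [i]. *)
Lemma lie_deriv_coord_vfield U (f : M -> R) i k p :
  smooth_fun U f -> U p -> dom i p ->
  lie_deriv (coord_vfield i k) f p =
  'D_(delta_mx 0 k) (f \o param i) (chart i p).
Proof.
move=> sf Up di; rewrite (@derive_change_chart _ f i (chart_at p)) //.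
  exact: chart_atP.
exact: smooth_fun_differentiable sf Up (chart_atP p).
Qed.

(** The components in a chart [j] are partial derivatives of the transition map from [i] to [j];
    they are then read in a third chart [m] through [chart i \o param m]. *)
Lemma smooth_vfield_coord i k : smooth_vfield (dom i) (coord_vfield i k).
Proof.
move=> j l; have oij : open (dom i `&` dom j) by apply: openI; exact: dom_open.
apply: (@smooth_fun_eq _
  (fun q => 'D_(delta_mx 0 k) (coord j l \o param i) (chart i q))) => //.
  by move=> q [di dj]; rewrite (lie_deriv_coord_vfield _ (@smooth_fun_coord j l)).
move=> m r.
apply: (@Ck_comp _ _ _ r (chart m @` ((dom i `&` dom j) `&` dom m))
  (chart i @` (dom j `&` dom i)) (chart i \o param m)
  (fun u => 'D_(delta_mx 0 k) (coord j l \o param i) u)).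
- exact: chart_image_open.
- by move=> _ [q [[di dj] dm] <-] /=; rewrite chartK //; exists q.
- apply: Ck_sub (transition_smooth m i r) => _ [q [[di dj] dm] <-].
  by exists q.
(* Order [r.+1] of the coordinate function pays for the partial derivative. *)
- by have [_ H] := @smooth_fun_coord j l i r.+1; exact: H.
Qed.

Lemma smooth_vfield_sub U U' X :
  U `<=` U' -> smooth_vfield U' X -> smooth_vfield U X.
Proof.
move=> UU' sX i k; apply: smooth_fun_sub (sX i k) => q [Uq dq].
by split=> //; exact: UU'.
Qed.

Lemma smooth_vfield_eq U X Y : open U -> (forall p, U p -> X p = Y p) ->
  smooth_vfield U X -> smooth_vfield U Y.
Proof.
move=> oU XY sX i k; apply: smooth_fun_eq (sX i k).
  by apply: openI => //; exact: dom_open.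
by move=> q [Uq dq]; rewrite /lie_deriv XY.
Qed.

Lemma lie_deriv_linl U (f : M -> R) (h : M -> R) X Y p :
  smooth_fun U f -> U p ->
  lie_deriv (fun q => h q *: X q + Y q) f p =
  h p * lie_deriv X f p + lie_deriv Y f p.
Proof.
move=> sf Up; have d := smooth_fun_differentiable sf Up (chart_atP p).
by rewrite /lie_deriv !deriveE // linearP.
Qed.

Lemma smooth_vfield_lin U (h : M -> R) X Y : open U -> smooth_fun U h ->
  smooth_vfield U X -> smooth_vfield U Y ->
  smooth_vfield U (fun q => h q *: X q + Y q).
Proof.
move=> oU sh sX sY i k.
have oUi : open (U `&` dom i) by apply: openI => //; exact: dom_open.
apply: (@smooth_fun_eq _ (fun q =>
  h q * lie_deriv X (coord i k) q + lie_deriv Y (coord i k) q)) => //.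
  by move=> q [Uq dq]; rewrite (lie_deriv_linl _ _ _ (@smooth_fun_coord i k)).
apply: smooth_funD => //; apply: smooth_funM => //.
by apply: smooth_fun_sub sh => q [].
Qed.

(** [X p] is the derivative along itself of [chart a \o param a], which is the identity near
    [chart a p]. Passing through the chart [i] and expanding the direction in the standard basis
    gives the sum. *)
Lemma vfield_coord_expansion X i p : dom i p ->
  X p = \sum_k lie_deriv X (coord i k) p *: coord_vfield i k p.
Proof.
move=> di; set a := chart_at p; have da : dom a p := chart_atP p.
have E : \forall u \near chart a p, (chart a \o param a) u = u.
  have oI := @chart_open _ _ M a.
  apply: (open_near_eq oI) => [|_ [q dq <-]] /=; first by exists p.
  by rewrite chartK.
have {1}-> : X p = 'D_(X p) (chart a \o param a) (chart a p).
  by rewrite (near_eq_derive _ E) derive_id.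
have d := transition_differentiable di da.
rewrite (derive_change_chart _ da di d) (derive_sum_delta _ d).
by apply: eq_bigr => k _; rewrite lie_deriv_coord.
Qed.

Lemma lie_deriv_cst X (a : R) p : lie_deriv X (cst a) p = 0.
Proof. exact: derive_cst. Qed.

Lemma smooth_vfield0 U : open U -> smooth_vfield U (fun=> 0).
Proof.
move=> oU i k; apply: smooth_fun_eq (smooth_fun_cst _ 0).
  by apply: openI => //; exact: dom_open.
by move=> q _; rewrite /lie_deriv derive0.
Qed.

Lemma smooth_vfieldD U X Y : open U -> smooth_vfield U X ->
  smooth_vfield U Y -> smooth_vfield U (fun q => X q + Y q).
Proof.
move=> oU sX sY.
have := smooth_vfield_lin oU (smooth_fun_cst U 1) sX sY.
by apply: smooth_vfield_eq => // q _; rewrite scale1r.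
Qed.

Lemma smooth_vfieldB U X Y : open U -> smooth_vfield U X ->
  smooth_vfield U Y -> smooth_vfield U (fun q => X q - Y q).
Proof.
move=> oU sX sY.
have := smooth_vfield_lin oU (smooth_fun_cst U (-1)) sY sX.
by apply: smooth_vfield_eq => // q _; rewrite scaleN1r addrC.
Qed.

Lemma lie_deriv_opp U (f h : M -> R) X p : open U -> smooth_fun U f -> U p ->
  (forall q, U q -> h q = - f q) -> lie_deriv X h p = - lie_deriv X f p.
Proof.
move=> oU sf Up fh; set a := chart_at p; have da : dom a p := chart_atP p.
have E : \forall u \near chart a p, (h \o param a) u = (- (f \o param a)) u.
  apply: (open_near_eq (chart_image_open (i := a) oU)); first by exists p.
  by move=> _ [q [Uq dq] <-] /=; rewrite fctE /= chartK // fh.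
rewrite /lie_deriv (near_eq_derive _ E) deriveN //.
by apply: diff_derivable; exact: smooth_fun_differentiable sf Up da.
Qed.

End SmoothFields.

(** * Traces with respect to a positive definite matrix *)

Section PositiveMatrices.
Context {R : realType}.

Definition mxform n (G : 'M[R]_n) (u v : 'rV[R]_n) : R := (u *m G *m v^T) 0 0.

Lemma mxformDl n (G : 'M[R]_n) u v w :
  mxform G (u + v) w = mxform G u w + mxform G v w.
Proof. by rewrite /mxform !mulmxDl mxE. Qed.

Lemma mxformNl n (G : 'M[R]_n) u v : mxform G (- u) v = - mxform G u v.
Proof. by rewrite /mxform !mulNmx mxE. Qed.

Lemma mxformC n (G : 'M[R]_n) u v : G^T = G -> mxform G u v = mxform G v u.
Proof.
move=> sG; rewrite /mxform -[in LHS](trmxK (u *m G *m v^T)) [in LHS]mxE.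
by rewrite !trmx_mul trmxK sG mulmxA.
Qed.

Definition posdef n (H : 'M[R]_n) : Prop :=
  forall u : 'rV[R]_n, u != 0 -> 0 < (u *m H *m u^T) 0 0.

Lemma posdef_dot_eq0 n (H : 'M[R]_n) (u : 'rV[R]_n) :
  posdef H -> mxform H u u = 0 -> u = 0.
Proof.
by move=> pH h; apply/eqP/contraT => /pH; rewrite -/(mxform H u u) h ltxx.
Qed.

(* Cholesky factorization, by induction on the Schur complement. *)
Lemma posdef_factor n (H : 'M[R]_n) : H^T = H -> posdef H ->
  exists B : 'M[R]_n, H = B *m B^T.
Proof.
elim: n H => [|n IH] H; first by exists 0; apply/matrixP => -[].
rewrite -[H](@submxK _ 1 n 1 n).
set a := ulsubmx _; set b := ursubmx _; set b' := dlsubmx _; set C := drsubmx _.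
rewrite (@tr_block_mx _ 1 n 1 n) => /(@eq_block_mx _ 1 n 1 n)[_ bb' _ CT] pH.
have {}bb' : b = b'^T by [].
(* This is the value of the form at the first basis vector. *)
have a0 : 0 < a 0 0.
  have := pH (@row_mx _ 1 1 n 1%:M 0).
  rewrite (@mul_row_block _ 1 1 n 1 n) !mul0mx !addr0 !mul1mx.
  rewrite (@tr_row_mx _ 1 1 n) (@mul_row_col _ 1 1 n 1) trmx0 mulmx0 addr0.
  rewrite trmx1 mulmx1; apply; apply/eqP.
  rewrite -(@row_mx0 _ 1 1 n) => /(@eq_row_mx _ 1 1 n)[/matrixP/(_ 0 0)].
  by rewrite !mxE => /eqP; rewrite oner_eq0.
have am : a = (a 0 0)%:M by rewrite -mx11_scalar.
pose S := C - (a 0 0)^-1 *: (b' *m b'^T).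
have ST : S^T = S by rewrite /S linearB linearZ /= trmx_mul trmxK CT.
have pS : posdef S.
  (* The first entry of [w] completes the square: the block form at [w] takes the value of [S] at
     [u]. *)
  move=> u u0; pose w := @row_mx _ 1 1 n (- (a 0 0)^-1 *: (u *m b')) u.
  have /pH : w != 0.
    by apply: contraNneq u0; rewrite -(@row_mx0 _ 1 1 n) => /(@eq_row_mx _ 1 1 n)[_ ->].
  rewrite /w (@mul_row_block _ 1 1 n 1 n) (@tr_row_mx _ 1 1 n) (@mul_row_col _ 1 1 n 1).
  suff -> : (- (a 0 0)^-1 *: (u *m b')) *m a + u *m b' = 0.
    rewrite mul0mx add0r /S mulmxBr -scalemxAr mulmxBl -scalemxAl bb'.
    by rewrite -!scalemxAl -mulmxA scaleNr addrC mulmxBl -scalemxAl.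
  rewrite [X in _ *m X]am mul_mx_scalar scalerA mulrN divff ?scaleN1r ?addNr //.
  exact: lt0r_neq0.
have [B SB] := IH S ST pS.
pose s := Num.sqrt (a 0 0).
have ss : s * s = a 0 0 by rewrite -expr2 sqr_sqrtr // ltW.
have s0 : s != 0 by rewrite gt_eqF // sqrtr_gt0.
(* The factor is block lower triangular, with the square root of the pivot and the factor [B] of the
   Schur complement on the diagonal. *)
exists (@block_mx _ 1 n 1 n s%:M 0 (s^-1 *: b') B).
rewrite (@tr_block_mx _ 1 n 1 n) (@mulmx_block _ 1 n 1 n 1 n) trmx0 !mul0mx !mulmx0 !addr0.
rewrite tr_scalar_mx linearZ /= -scalar_mxM ss -am mul_scalar_mx mul_mx_scalar.
rewrite !scalerA divff // !scale1r -bb' -SB -scalemxAl -scalemxAr scalerA -invfM ss.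
by rewrite bb' /S addrC subrK.
Qed.

Lemma posdef_unit n (H : 'M[R]_n) : posdef H -> H \in unitmx.
Proof.
move=> pH; rewrite -row_free_unit -kermx_eq0; apply/eqP/row_matrixP => i.
rewrite row0; apply: (posdef_dot_eq0 pH).
by rewrite /mxform (sub_kermxP (row_sub i (kermx H))) mul0mx mxE.
Qed.

(** If H = B B^T, then the inverse is C C^T with C = (B^-1)^T. This turns traces against [invmx H]
    into sums of squares. *)
Lemma posdef_invmx_factor n (H : 'M[R]_n) : H^T = H -> posdef H ->
  exists C : 'M[R]_n, C \in unitmx /\ invmx H = C *m C^T.
Proof.
move=> sH pH; have [B HB] := posdef_factor sH pH.
have uB : B \in unitmx.
  by have := posdef_unit pH; rewrite HB unitmx_mul => /andP[].
exists (invmx B)^T; rewrite unitmx_tr unitmx_inv uB; split=> //.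
have uBT : B^T \in unitmx by rewrite unitmx_tr.
rewrite trmxK trmx_inv -[RHS](mulKmx (posdef_unit pH)).
suff -> : H *m (invmx B^T *m invmx B) = 1%:M by rewrite mulmx1.
by rewrite HB mulmxA mulmxK // mulmxV.
Qed.

Lemma trace_mul_tr_ge0 n (D : 'M[R]_n) : 0 <= \tr (D *m D^T).
Proof.
rewrite sumr_ge0 // => i _; rewrite mxE sumr_ge0 // => j _.
by rewrite mxE -expr2 sqr_ge0.
Qed.

Lemma trace_mul_tr_eq0 n (D : 'M[R]_n) : \tr (D *m D^T) = 0 -> D = 0.
Proof.
have h i : 0 <= (D *m D^T) i i.
  by rewrite mxE sumr_ge0 // => j _; rewrite mxE -expr2 sqr_ge0.
move=> /eqP; rewrite psumr_eq0 // => /allP /= H; apply/matrixP => i j.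
have := H i (mem_index_enum _); rewrite mxE psumr_eq0 => [/allP/(_ j (mem_index_enum _))|k _].
  by rewrite !mxE mulf_eq0 orbb => /eqP.
by rewrite mxE -expr2 sqr_ge0.
Qed.

(* The indices are ordered as in R(e_k, e_i, e_j, e_l) in [scalar_curvature]. *)
Definition contract4 n (G : 'M[R]_n) (E : 'I_n -> 'I_n -> 'I_n -> 'I_n -> R) : R :=
  \sum_i \sum_j G i j * \sum_k \sum_l G k l * E k i j l.

Lemma contract4E n (G : 'M[R]_n) E : contract4 G E =
  \sum_i \sum_j \sum_k \sum_l G i j * G k l * E k i j l.
Proof.
apply: eq_bigr => i _; apply: eq_bigr => j _; rewrite mulr_sumr.
by apply: eq_bigr => k _; rewrite mulr_sumr; apply: eq_bigr => l _; rewrite mulrA.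
Qed.

Lemma contract4D n (G : 'M[R]_n) E F : contract4 G (fun k i j l => E k i j l + F k i j l) =
  contract4 G E + contract4 G F.
Proof.
rewrite !contract4E -big_split; apply: eq_bigr => i _ /=.
rewrite -big_split; apply: eq_bigr => j _ /=.
rewrite -big_split; apply: eq_bigr => k _ /=.
by rewrite -big_split; apply: eq_bigr => l _ /=; rewrite mulrDr.
Qed.

Lemma contract4_sum n m (G : 'M[R]_n) (E : 'I_m -> 'I_n -> 'I_n -> 'I_n -> 'I_n -> R) :
  contract4 G (fun k i j l => \sum_c E c k i j l) = \sum_c contract4 G (E c).
Proof.
elim: m E => [|m IH] E.
  rewrite big_ord0 contract4E big1 // => i _; rewrite big1 // => j _.
  by rewrite big1 // => k _; rewrite big1 // => l _; rewrite big_ord0 mulr0.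
rewrite big_ord_recl -IH -contract4D; congr contract4.
by do 4!(apply: funext => ?); rewrite big_ord_recl.
Qed.

Lemma contract4_swap n (G : 'M[R]_n) E : G^T = G ->
  contract4 G (fun k i j l => E k j i l) = contract4 G E /\
  contract4 G (fun k i j l => E l i j k) = contract4 G E.
Proof.
move=> sG; have Gs i j : G i j = G j i by rewrite -[in LHS]sG mxE.
rewrite !contract4E; split.
  rewrite exchange_big; apply: eq_bigr => j _; apply: eq_bigr => i _.
  by apply: eq_bigr => k _; apply: eq_bigr => l _; rewrite [G i j]Gs.
apply: eq_bigr => i _; apply: eq_bigr => j _.
rewrite exchange_big; apply: eq_bigr => k _; apply: eq_bigr => l _.
by rewrite [G l k]Gs.
Qed.

(** A symmetric [G] gives the same contraction to the four copies of [E] obtained by swapping [i]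
    with [j] and [k] with [l], so four times the contraction vanishes. *)
Lemma contract4_eq0 n (G : 'M[R]_n) E : G^T = G ->
  (forall k i j l, E k i j l + E k j i l + E l i j k + E l j i k = 0) ->
  contract4 G E = 0.
Proof.
move=> sG h; have [h1 h2] := contract4_swap E sG.
have [_ h3] := contract4_swap (fun k i j l => E k j i l) sG.
have : contract4 G E + contract4 G (fun k i j l => E k j i l) +
    contract4 G (fun k i j l => E l i j k) +
    contract4 G (fun k i j l => E l j i k) = 0.
  rewrite -!contract4D contract4E.
  by do 4!(rewrite big1 // => ? _); rewrite h mulr0.
rewrite h3 h2 h1 -mulr2n -!mulrSr => /eqP.
by rewrite mulrn_eq0 => /eqP.
Qed.

(** The left side is tr(G A G A^T); moving one factor of G = C C^T around the trace exhibits the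
    squared Frobenius norm of C^T A C. *)
Lemma contract4_square n (G C A : 'M[R]_n) : G = C *m C^T ->
  contract4 G (fun k i j l => A i k * A j l) =
  \tr ((C^T *m A *m C) *m (C^T *m A *m C)^T).
Proof.
move=> GC; have sG : G^T = G by rewrite GC trmx_mul trmxK.
transitivity (\tr (G *m (A *m G *m A^T))).
  apply: eq_bigr => i _; rewrite [RHS]mxE; apply: eq_bigr => j _.
  have -> : (A *m G *m A^T) j i = (A *m G *m A^T) i j.
    have {1}-> : A *m G *m A^T = (A *m G *m A^T)^T.
      by rewrite !trmx_mul trmxK sG mulmxA.
    by rewrite mxE.
  congr (_ * _); rewrite mxE exchange_big; apply: eq_bigr => l _ /=.
  rewrite !mxE mulr_suml; apply: eq_bigr => k _.
  by rewrite mulrA [G k l * _]mulrC.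
rewrite GC -[in LHS]mulmxA mxtrace_mulC; congr (\tr _).
by rewrite !trmx_mul trmxK !mulmxA.
Qed.

(** Definiteness of the squared norm of a vector-valued bilinear form. A factorization of [H] splits
    the contraction over the components [c], and one of [invmx H] makes each part a squared
    Frobenius norm; a zero sum of squares has zero terms. *)
Lemma contract4_dot_eq0 n (H : 'M[R]_n) (v : 'I_n -> 'I_n -> 'rV[R]_n) :
  H^T = H -> posdef H ->
  contract4 (invmx H) (fun k i j l => mxform H (v i k) (v j l)) = 0 ->
  forall i k, v i k = 0.
Proof.
move=> sH pH; have [B HB] := posdef_factor sH pH.
have [C [uC HC]] := posdef_invmx_factor sH pH.
pose A c := \matrix_(i, k) (v i k *m B) 0 c.
have -> : (fun k i j l => mxform H (v i k) (v j l)) =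
    (fun k i j l => \sum_c A c i k * A c j l).
  do 4!(apply: funext => ?); rewrite /mxform {1}HB mulmxA -mulmxA -trmx_mul mxE.
  by apply: eq_bigr => c _; rewrite !mxE.
rewrite contract4_sum; under eq_bigr do rewrite (contract4_square _ HC).
move=> /eqP; rewrite psumr_eq0 => [/allP h i k|c _]; last exact: trace_mul_tr_ge0.
(* The vanishing matrix is C^T (A c) C, and [C] is invertible. *)
have A0 c : A c = 0.
  have /eqP/trace_mul_tr_eq0 D0 := h c (mem_index_enum _).
  have uCT : C^T \in unitmx by rewrite unitmx_tr.
  by rewrite -[A c](mulKmx uCT) -[C^T *m _](mulmxK uC) D0 mul0mx mulmx0.
have vB : v i k *m B = 0.
  apply/rowP => c; have /matrixP/(_ i k) := A0 c.
  by rewrite [A c i k]mxE => ->; rewrite !mxE.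
apply: (posdef_dot_eq0 pH).
by rewrite /mxform {1}HB mulmxA vB !mul0mx mxE.
Qed.

End PositiveMatrices.

(** * The difference of the two connections *)

#[local] Opaque smooth_vfield smooth_fun lie_deriv bracket.

Section ConnectionDifference.
Context {R : realType} {n : nat} {M : smoothManifold R n}.
Context (g : M -> 'M[R]_n) (nab nab' : connection M).
Context (hg : riemannian_metric g) (hLC : levi_civita g nab)
  (hg' : parallel_metric nab' g) (hskew : skew_torsion g nab').
Implicit Types (U : set M) (p : M) (X Y Z W : vfield M).

Local Notation dot p := (mxform (g p)).

Let gsym p : (g p)^T = g p := Defs.metric_sym hg p.
Let gpos p : posdef (g p) := @metric_pos _ _ _ _ hg p.

Lemma inner_dot X Y p : inner g X Y p = dot p (X p) (Y p).
Proof. by []. Qed.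

Definition conn_diff X Y : vfield M := fun q => nab' X Y q - nab X Y q.
Local Notation K := conn_diff.

Lemma conn_diffE X Y : nab' X Y = (fun q => nab X Y q + K X Y q).
Proof. by apply: funext => q; rewrite addrC subrK. Qed.

(** * Symmetries of the difference tensor and comparison of the curvatures *)

Section OnOpen.
Context (U : set M) (oU : open U).
Local Notation sm := (smooth_vfield U).

Lemma conn_diff_smooth X Y : sm X -> sm Y -> sm (K X Y).
Proof.
by move=> sX sY; exact: smooth_vfieldB oU (conn_smooth nab' oU sX sY)
  (conn_smooth nab oU sX sY).
Qed.

Lemma conn_diff_local X X' Y Y' : sm X -> sm Y ->
  (forall p, U p -> X p = X' p) -> (forall p, U p -> Y p = Y' p) ->
  forall p, U p -> K X Y p = K X' Y' p.
Proof.
move=> sX sY eX eY p Up.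
by rewrite /K (conn_local nab' oU sX sY eX eY Up) (conn_local nab oU sX sY eX eY Up).
Qed.

Lemma conn_diff_linl (f : M -> R) X X' Y : smooth_fun U f ->
  sm X -> sm X' -> sm Y -> forall p, U p ->
  K (fun q => f q *: X q + X' q) Y p = f p *: K X Y p + K X' Y p.
Proof.
move=> sf sX sX' sY p Up.
rewrite /K (conn_linl nab' oU sf sX sX' sY Up) (conn_linl nab oU sf sX sX' sY Up).
by rewrite opprD addrACA -scalerBr.
Qed.

Lemma conn_diff_addr X Y Y' : sm X -> sm Y -> sm Y' -> forall p, U p ->
  K X (fun q => Y q + Y' q) p = K X Y p + K X Y' p.
Proof.
move=> sX sY sY' p Up.
rewrite /K (conn_addr nab' oU sX sY sY' Up) (conn_addr nab oU sX sY sY' Up).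
by rewrite opprD addrACA.
Qed.

Lemma conn_subl (D : connection M) X X' Y : sm X -> sm X' -> sm Y ->
  forall p, U p -> D (fun q => X q - X' q) Y p = D X Y p - D X' Y p.
Proof.
move=> sX sX' sY p Up.
have -> : (fun q => X q - X' q) = (fun q => cst (-1 : R) q *: X' q + X q).
  by apply: funext => q; rewrite scaleN1r addrC.
rewrite (conn_linl D oU (smooth_fun_cst U (-1)) sX' sX sY Up).
by rewrite scaleN1r addrC.
Qed.

Lemma conn_oppr (D : connection M) X Y : sm X -> sm Y ->
  forall p, U p -> D X (fun q => - Y q) p = - D X Y p.
Proof.
move=> sX sY p Up.
have -> : (fun q => - Y q) = (fun q => cst (-1 : R) q *: Y q).
  by apply: funext => q; rewrite scaleN1r.
rewrite (conn_leibniz D oU (smooth_fun_cst U (-1)) sX sY Up).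
by rewrite lie_deriv_cst scale0r add0r scaleN1r.
Qed.

Lemma bracketE X Y : sm X -> sm Y -> forall p, U p ->
  bracket X Y p = nab X Y p - nab Y X p.
Proof.
move=> sX sY p Up; have := hLC.2 U X Y oU sX sY p Up.
by rewrite /torsion => /eqP; rewrite subr_eq0 => /eqP.
Qed.

(** Absence of torsion trades the bracket for covariant derivatives, whose smoothness comes from
    [conn_smooth]. The two fields agree only on [U], hence the appeal to [conn_local]. *)
Lemma conn_bracket (D : connection M) X Y Z : sm X -> sm Y -> sm Z ->
  forall p, U p ->
  D (bracket X Y) Z p = D (nab X Y) Z p - D (nab Y X) Z p.
Proof.
move=> sX sY sZ p Up.
have sXY := conn_smooth nab oU sX sY; have sYX := conn_smooth nab oU sY sX.
rewrite -(conn_subl D sXY sYX sZ Up).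
have sB := smooth_vfieldB oU sXY sYX.
have eB q : U q -> nab X Y q - nab Y X q = bracket X Y q.
  by move=> Uq; rewrite (bracketE sX sY Uq).
exact/esym/(conn_local D oU sB sZ eB (fun q _ => erefl) Up).
Qed.

Lemma torsion_conn_diff X Y p : sm X -> sm Y -> U p ->
  torsion nab' X Y p = K X Y p - K Y X p.
Proof.
move=> sX sY Up; rewrite /torsion (bracketE sX sY Up).
by apply/rowP => k; rewrite !mxE; ring.
Qed.

(** Both connections preserve [g], and the term [lie_deriv X (inner g Y Z)] is common to the two
    identities, so it drops out of their difference. *)
Lemma conn_diff_metric X Y Z p : sm X -> sm Y -> sm Z -> U p ->
  dot p (K X Y p) (Z p) = - dot p (K X Z p) (Y p).
Proof.
move=> sX sY sZ Up.
have := hLC.1 U X Y Z oU sX sY sZ p Up.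
have := hg' oU sX sY sZ Up.
rewrite /cov_metric !inner_dot ![dot p (Y p) _]mxformC // !mxformDl !mxformNl.
lra.
Qed.

Lemma torsion3_conn_diff X Y Z p : sm X -> sm Y -> U p ->
  torsion3 g nab' X Y Z p = dot p (K X Y p) (Z p) - dot p (K Y X p) (Z p).
Proof.
move=> sX sY Up; rewrite /torsion3 inner_dot (torsion_conn_diff sX sY Up).
by rewrite mxformDl mxformNl.
Qed.

#[local] Opaque inner mxform torsion torsion3 conn_diff.

(** Put k(X, Y, Z) = g(K(X, Y), Z), which is skew in its last two slots. Modulo this, each of [h1],
    [h2], [h3] says that two of k(X, Y, Z), k(Y, Z, X), k(Z, X, Y) coincide, and the goal is k(X, Y,
    Z) = k(Y, Z, X). *)
Lemma conn_diff_skew X Y Z p : sm X -> sm Y -> sm Z -> U p ->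
  dot p (K X Y p) (Z p) = - dot p (K Y X p) (Z p).
Proof.
move=> sX sY sZ Up.
have [_ h1] := hskew oU sX sY sZ Up.
have [_ h2] := hskew oU sY sZ sX Up.
have [_ h3] := hskew oU sZ sX sY Up.
rewrite (torsion3_conn_diff _ sX sY Up) (torsion3_conn_diff _ sX sZ Up) in h1.
rewrite (torsion3_conn_diff _ sY sZ Up) (torsion3_conn_diff _ sY sX Up) in h2.
rewrite (torsion3_conn_diff _ sZ sX Up) (torsion3_conn_diff _ sZ sY Up) in h3.
move: h1 h2 h3.
have := conn_diff_metric sX sY sZ Up.
have := conn_diff_metric sY sZ sX Up.
have := conn_diff_metric sZ sX sY Up.
lra.
Qed.

Lemma conn_diffC X Y p : sm X -> sm Y -> U p -> K X Y p = - K Y X p.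
Proof.
move=> sX sY Up; apply/eqP; rewrite -addr_eq0; apply/eqP.
(* The sum K(X, Y) + K(Y, X) is tested against itself. *)
have sK := smooth_vfieldD oU (conn_diff_smooth sX sY) (conn_diff_smooth sY sX).
apply: (posdef_dot_eq0 (gpos p)).
by rewrite mxformDl (conn_diff_skew sX sY sK Up) addNr.
Qed.

Lemma conn_diff_cycle X Y Z p : sm X -> sm Y -> sm Z -> U p ->
  dot p (K X Y p) (Z p) = dot p (K Z X p) (Y p).
Proof.
move=> sX sY sZ Up.
by rewrite (conn_diff_metric sX sY sZ Up) (conn_diff_skew sX sZ sY Up) opprK.
Qed.

Lemma curvature_diff X Y Z p : sm X -> sm Y -> sm Z -> U p ->
  curvature nab' X Y Z p = curvature nab X Y Z p
  + (nab X (K Y Z) p + K X (nab Y Z) p + K X (K Y Z) p)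
  - (nab Y (K X Z) p + K Y (nab X Z) p + K Y (K X Z) p)
  - (K (nab X Y) Z p - K (nab Y X) Z p).
Proof.
move=> sX sY sZ Up; rewrite /curvature.
rewrite !(conn_bracket _ sX sY sZ Up).
have h (A B : vfield M) : sm A -> sm B ->
    nab' A (nab' B Z) p =
    nab A (nab B Z) p + (nab A (K B Z) p + K A (nab B Z) p + K A (K B Z) p).
  move=> sA sB; rewrite [nab' B Z]conn_diffE conn_diffE.
  have sN := conn_smooth nab oU sB sZ; have sK := conn_diff_smooth sB sZ.
  rewrite (conn_addr nab oU sA sN sK Up) (conn_diff_addr sA sN sK Up).
  by rewrite !addrA.
rewrite !h // [nab' (nab X Y) Z]conn_diffE [nab' (nab Y X) Z]conn_diffE.
set a := nab X (nab Y Z) p; set b := _ + K X (K Y Z) p.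
set c := nab Y (nab X Z) p; set d := _ + K Y (K X Z) p.
set e := nab (nab X Y) Z p; set f := nab (nab Y X) Z p.
set u := K (nab X Y) Z p; set v := K (nab Y X) Z p.
by apply/rowP => k; rewrite !mxE; ring.
Qed.

Lemma inner_conn_diff_smooth X Y Z : sm X -> sm Y -> sm Z ->
  smooth_fun U (inner g (K X Y) Z).
Proof.
by move=> sX sY sZ; exact: (metric_smooth hg oU (conn_diff_smooth sX sY) sZ).
Qed.

(** Plays the role of an integration by parts: it moves the derivative to the other factor. *)
Lemma conn_metric X Y Z p : sm X -> sm Y -> sm Z -> U p ->
  dot p (nab X Y p) (Z p) =
  lie_deriv X (inner g Y Z) p - dot p (Y p) (nab X Z p).
Proof.
move=> sX sY sZ Up; have := hLC.1 U X Y Z oU sX sY sZ p Up.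
by rewrite /cov_metric !inner_dot; lra.
Qed.

Lemma lie_deriv_conn_diff X Y Z W p : sm X -> sm Y -> sm Z -> U p ->
  lie_deriv W (inner g (K X Y) Z) p = - lie_deriv W (inner g (K Z Y) X) p.
Proof.
move=> sX sY sZ Up; apply: lie_deriv_opp oU (inner_conn_diff_smooth sZ sY sX) Up _.
move=> q Uq; rewrite !inner_dot (conn_diff_cycle sX sY sZ Uq).
exact: conn_diff_metric.
Qed.

Lemma nab_conn_diffC X Y Z p : sm X -> sm Y -> sm Z -> U p ->
  nab X (K Y Z) p = - nab X (K Z Y) p.
Proof.
move=> sX sY sZ Up; have sK := conn_diff_smooth sZ sY.
rewrite -(conn_oppr nab sX sK Up).
apply: (conn_local nab oU sX (conn_diff_smooth sY sZ)) => // q Uq.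
exact: conn_diffC.
Qed.

(** The two derivatives of [K] are treated differently on purpose: the one along [X] stays and is
    skew in [Y], [Z], while the one along [Y] becomes a Lie derivative of a function skew in [X],
    [W]. Each then cancels under one of the two symmetrizations. *)
Lemma curvature4_diff X Y Z W p : sm X -> sm Y -> sm Z -> sm W -> U p ->
  curvature4 g nab' X Y Z W p = curvature4 g nab X Y Z W p
  + dot p (nab X (K Y Z) p) (W p)
  + dot p (K W X p) (nab Y Z p) + dot p (K W X p) (K Y Z p)
  - lie_deriv Y (inner g (K X Z) W) p + dot p (K X Z p) (nab Y W p)
  - dot p (K W Y p) (nab X Z p) - dot p (K W Y p) (K X Z p)
  - dot p (K Z W p) (nab X Y p) + dot p (K Z W p) (nab Y X p).
Proof.
move=> sX sY sZ sW Up; rewrite /curvature4 !inner_dot (curvature_diff sX sY sZ Up).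
have dotE r a b c d e f u v w : dot p (r + (a + b + c) - (d + e + f) - (u - v)) w =
    dot p r w + (dot p a w + dot p b w + dot p c w)
    - (dot p d w + dot p e w + dot p f w) - (dot p u w - dot p v w).
  by rewrite !(mxformDl, mxformNl).
rewrite dotE.
have sn (A B : vfield M) : sm A -> sm B -> sm (nab A B) := conn_smooth nab oU.
have sK := conn_diff_smooth.
rewrite (conn_metric (Y := K X Z) sY (sK _ _ sX sZ) sW Up).
(* Cyclic symmetry brings covariant derivatives and inner values of [K] out of the arguments of the
   outer [K]; a derivative in the first slot takes two turns. *)
rewrite (conn_diff_cycle sX (sn _ _ sY sZ) sW Up).
rewrite (conn_diff_cycle sX (sK _ _ sY sZ) sW Up).
rewrite (conn_diff_cycle sY (sn _ _ sX sZ) sW Up).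
rewrite (conn_diff_cycle sY (sK _ _ sX sZ) sW Up).
rewrite (conn_diff_cycle (sn _ _ sX sY) sZ sW Up).
rewrite (conn_diff_cycle sW (sn _ _ sX sY) sZ Up).
rewrite (conn_diff_cycle (sn _ _ sY sX) sZ sW Up).
rewrite (conn_diff_cycle sW (sn _ _ sY sX) sZ Up).
ring.
Qed.

(* All terms of [curvature4_diff] except the square of [K] cancel under a trace
   symmetric in [X], [W] and in [Y], [Z]. *)
Lemma curvature4_diff_sym X Y Z W p : sm X -> sm Y -> sm Z -> sm W -> U p ->
  let E X Y Z W := curvature4 g nab' X Y Z W p - curvature4 g nab X Y Z W p
    + dot p (K Y X p) (K Z W p) in
  E X Y Z W + E X Z Y W + E W Y Z X + E W Z Y X = 0.
Proof.
move=> sX sY sZ sW Up E; rewrite /E !curvature4_diff //.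
(* Covariant derivatives of [K] cancel between copies with [Y], [Z] swapped, Lie derivatives between
   copies with [X], [W] swapped. The later rewrites fix one orientation of [K] for each pair, so
   that the products match. *)
rewrite (nab_conn_diffC sX sZ sY Up) (nab_conn_diffC sW sZ sY Up) !mxformNl.
rewrite (lie_deriv_conn_diff Y sX sZ sW Up) (lie_deriv_conn_diff Z sX sY sW Up).
rewrite (conn_diffC sW sX Up) (conn_diffC sW sY Up) (conn_diffC sW sZ Up).
rewrite (conn_diffC sY sX Up) (conn_diffC sZ sX Up) (conn_diffC sZ sY Up).
rewrite !mxformNl ![dot p _ (- _)]mxformC // !mxformNl.
rewrite ![dot p (K Y Z p) _]mxformC // ![dot p (K Z W p) _]mxformC //.
rewrite ![dot p (K Y W p) _]mxformC //.
ring.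
Qed.

End OnOpen.

(** * From curvature to scalar curvature *)

Lemma coord_vfield_chart_at p k : coord_vfield (chart_at p) k p = delta_mx 0 k.
Proof.
set a := chart_at p; have da : dom a p := chart_atP p.
have E : \forall u \near chart a p, (chart a \o param a) u = u.
  have oI := @chart_open _ _ M a.
  apply: (open_near_eq oI) => [|_ [q dq <-]] /=; first by exists p.
  by rewrite chartK.
by rewrite /coord_vfield -/a (near_eq_derive _ E) derive_id.
Qed.

(** At [p] the coordinate frame of [chart_at p] is the standard basis, so its Gram matrix is [g p]
    itself. *)
Lemma inv_gram_chart_at p : inv_gram g (coord_vfield (chart_at p)) p = invmx (g p).
Proof.
congr invmx; apply/matrixP => i j; rewrite mxE inner_dot !coord_vfield_chart_at.
by rewrite /mxform -rowE trmx_delta -colE !mxE.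
Qed.

Lemma scalar_curvature_diff p :
  let e := coord_vfield (chart_at p) in
  scalar_curvature g nab' p = scalar_curvature g nab p -
  contract4 (invmx (g p))
    (fun k i j l => dot p (K (e i) (e k) p) (K (e j) (e l) p)).
Proof.
have oU := dom_open (chart_at p); have Up := chart_atP p.
pose e := coord_vfield (chart_at p); have se i : smooth_vfield _ (e i) := smooth_vfield_coord _ i.
have sG : (invmx (g p))^T = invmx (g p) by rewrite trmx_inv gsym.
pose r (D : connection M) k i j l := curvature4 g D (e k) (e i) (e j) (e l) p.
pose q k i j l := dot p (K (e i) (e k) p) (K (e j) (e l) p).
have tauE D : scalar_curvature g D p = contract4 (invmx (g p)) (r D).
  by rewrite -inv_gram_chart_at.
(* The difference of the curvatures corrected by the square of [K] has vanishing symmetrization, so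
   its double trace is zero. *)
have E0 : contract4 (invmx (g p))
    (fun k i j l => r nab' k i j l - r nab k i j l + q k i j l) = 0.
  apply: contract4_eq0 => // k i j l.
  exact: (curvature4_diff_sym oU (se k) (se i) (se j) (se l) Up).
have : contract4 (invmx (g p)) (fun k i j l =>
    (r nab' k i j l - r nab k i j l + q k i j l) + r nab k i j l) =
    contract4 (invmx (g p)) (fun k i j l => r nab' k i j l + q k i j l).
  by congr contract4; do 4!(apply: funext => ?); rewrite addrAC subrK.
rewrite contract4D E0 add0r contract4D -!tauE => -> /=.
by rewrite addrK.
Qed.

(** * Reduction of the difference tensor to a coordinate frame *)

Lemma conn_diff_suml U m (f : 'I_m -> M -> R) (e : 'I_m -> vfield M) Y :
  open U -> (forall i, smooth_fun U (f i)) ->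
  (forall i, smooth_vfield U (e i)) -> smooth_vfield U Y ->
  smooth_vfield U (fun q => \sum_i f i q *: e i q) /\
  forall p, U p ->
    K (fun q => \sum_i f i q *: e i q) Y p = \sum_i f i p *: K (e i) Y p.
Proof.
move=> oU; elim: m f e => [|m IH] f e sf se sY.
  have s0 := smooth_vfield0 oU.
  have -> : (fun q => \sum_(i < 0) f i q *: e i q) = (fun=> 0).
    by apply: funext => q; rewrite big_ord0.
  split=> // p Up; rewrite big_ord0.
  (* Writing the zero field as 1 0 + 0 gives K(0, Y) = K(0, Y) + K(0, Y). *)
  have := conn_diff_linl oU (smooth_fun_cst U 1) s0 s0 sY Up.
  have -> : (fun q : M => 1 *: 0 + 0 : 'rV[R]_n) = (fun=> 0).
    by apply: funext => q; rewrite scaler0 addr0.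
  by rewrite scale1r => /eqP; rewrite -subr_eq subrr eq_sym => /eqP.
have [s1 h1] := IH (fun i => f (lift ord0 i)) (fun i => e (lift ord0 i))
  (fun i => sf _) (fun i => se _) sY.
have -> : (fun q => \sum_(i < m.+1) f i q *: e i q) = (fun q => f ord0 q *: e ord0 q +
    \sum_(i < m) f (lift ord0 i) q *: e (lift ord0 i) q).
  by apply: funext => q; rewrite big_ord_recl.
split=> [|p Up]; first exact: smooth_vfield_lin.
by rewrite (conn_diff_linl oU (sf ord0) (se ord0) s1 sY Up) h1 // big_ord_recl.
Qed.

Lemma conn_diff_expansion U X Y i p : open U -> smooth_vfield U X ->
  smooth_vfield U Y -> U p -> dom i p ->
  K X Y p = \sum_k lie_deriv X (coord i k) p *: K (coord_vfield i k) Y p.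
Proof.
move=> oU sX sY Up di.
have oV : open (U `&` dom i) by apply: openI => //; exact: dom_open.
have sV Z : smooth_vfield U Z -> smooth_vfield (U `&` dom i) Z.
  by apply: smooth_vfield_sub => q [].
have se k : smooth_vfield (U `&` dom i) (coord_vfield i k).
  by apply: smooth_vfield_sub (smooth_vfield_coord i k) => q [].
have [_ <- //] := conn_diff_suml (f := fun k => lie_deriv X (coord i k)) oV
  (sX i) se (sV _ sY).
apply: (conn_diff_local oV (sV _ sX) (sV _ sY)) => // q [Uq dq].
exact: vfield_coord_expansion.
Qed.

(** Expand the first argument in the frame, exchange the arguments by skew symmetry, and expand
    again: linearity over functions in the first slot serves for both. *)
Lemma conn_diff_eq0_frame U X Y p : open U -> smooth_vfield U X ->
  smooth_vfield U Y -> U p ->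
  (forall i k, K (coord_vfield (chart_at p) i) (coord_vfield (chart_at p) k) p = 0) ->
  K X Y p = 0.
Proof.
move=> oU sX sY Up h; set a := chart_at p in h; have da : dom a p := chart_atP p.
have oV : open (U `&` dom a) by apply: openI => //; exact: dom_open.
have sV Z : smooth_vfield U Z -> smooth_vfield (U `&` dom a) Z.
  by apply: smooth_vfield_sub => q [].
have se k : smooth_vfield (U `&` dom a) (coord_vfield a k).
  by apply: smooth_vfield_sub (smooth_vfield_coord a k) => q [].
have Vp : (U `&` dom a) p by [].
rewrite (conn_diff_expansion oU sX sY Up da) big1 // => k _.
rewrite (conn_diffC oV (se k) (sV _ sY) Vp).
rewrite (conn_diff_expansion oV (sV _ sY) (se k) Vp da) big1 ?oppr0 ?scaler0 //.
by move=> l _; rewrite h scaler0.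
Qed.

(** The two scalar curvatures differ at [p] by the squared norm of [K], which is definite, so
    equality kills [K] on the frame at each point. *)
Lemma scalar_curvature_eq_conn_diff0 :
  scalar_curvature g nab = scalar_curvature g nab' <->
  (forall U X Y p, open U -> smooth_vfield U X -> smooth_vfield U Y -> U p ->
    K X Y p = 0).
Proof.
split=> [eqs U X Y p oU sX sY Up|K0].
  apply: (conn_diff_eq0_frame oU sX sY Up) => i k.
  apply: (contract4_dot_eq0 (gsym p) (gpos p)
    (v := fun i k => K (coord_vfield (chart_at p) i) (coord_vfield (chart_at p) k) p)).
  have := scalar_curvature_diff p; rewrite -eqs => /eqP.
  by rewrite -subr_eq0 opprB addrC subrK => /eqP.
apply: funext => p; rewrite scalar_curvature_diff contract4E big1 ?subr0 // => i _.
rewrite big1 // => j _; rewrite big1 // => k _; rewrite big1 // => l _.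
rewrite (K0 (dom (chart_at p)) (coord_vfield _ i)) ?/mxform ?mul0mx ?mxE ?mulr0 //.
- exact: dom_open.
- exact: smooth_vfield_coord.
- exact: smooth_vfield_coord.
- exact: chart_atP.
Qed.

End ConnectionDifference.

Theorem corollary2p5 (R : realType) (n : nat) (M : smoothManifold R n)
    (P g : M -> 'M[R]_n) (nab nab' : connection M)
    (hM : riemannian_almost_product P g)
    (hLC : levi_civita g nab)
    (hW3 : W3_manifold P g nab)
    (hRPT : RPT_connection P g nab')
    (hT : identically3 (fun (X Y Z : vfield M) (p : M) =>
       torsion3 g nab' X Y Z p =
       2^-1 * (Ftensor P g nab X Y (endo P Z) p
               + Ftensor P g nab Y Z (endo P X) p
               + Ftensor P g nab Z X (endo P Y) p))) :
  scalar_curvature g nab = scalar_curvature g nab' <->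
  riemannian_P_manifold P nab.
Proof.
have hg := rap_metric hM; have [hP hg' hskew] := hRPT.
rewrite (scalar_curvature_eq_conn_diff0 hg hLC hg' hskew).
split=> [K0 U X Y oU sX sY p Up|hPM U X Y p oU sX sY Up].
  (* With [K] zero both connections agree on smooth fields, and parallelism of [P] passes from
     [nab'] to [nab]. *)
  have nabE Z : smooth_vfield U Z -> nab X Z p = nab' X Z p.
    by move=> sZ; rewrite (conn_diffE nab nab') (K0 U X Z p) // addr0.
  rewrite -(hP U X Y oU sX sY p Up) /cov_endo /endo !nabE //.
  exact: (rap_smooth hM).
have sK := conn_diff_smooth nab nab' oU sX sY.
have F0 A B C : smooth_vfield U A -> smooth_vfield U B -> Ftensor P g nab A B C p = 0.
  move=> sA sB; rewrite /Ftensor inner_dot (hPM U A B oU sA sB p Up).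
  by rewrite /mxform !mul0mx mxE.
(* The torsion formula is tested on the third field K(X, Y): as T = 2 K and every [Ftensor] term
   vanishes, it says that 2 g(K(X, Y), K(X, Y)) = 0. *)
have := hT U X Y _ oU sX sY sK p Up.
rewrite !F0 // !addr0 mulr0 /torsion3 inner_dot (torsion_conn_diff nab' hLC oU sX sY Up).
rewrite [conn_diff nab nab' Y X p](conn_diffC hg hLC hg' hskew oU sY sX Up) opprK.
rewrite mxformDl => /eqP; rewrite -mulr2n mulrn_eq0 /= => /eqP.
by apply: posdef_dot_eq0; exact: metric_pos hg p.
Qed.
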